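(* Let $a,b$ be relatively prime positive integers. The skew length of an $(a,b)$-core $\kappa$ is independent of the ordering of $a$ and $b$: the number of boxes of $\kappa$ lying simultaneously in the $a$-rows and in the $b$-boundary of $\kappa$ equals the number of boxes of $\kappa$ lying simultaneously in the $b$-rows and in the $a$-boundary of $\kappa$.
   Context: The hook length of a box of the Young diagram of a partition (English notation) is the number of boxes directly to its right or directly below it, including the box itself. An $(a,b)$-core is a partition having no hook length equal to $a$ and none equal to $b$. For a partition $\kappa$ and a positive integer $m$: consider the hook lengths of the boxes in the first column of $\kappa$; for each residue modulo $m$ that occurs take the largest such hook length; the rows of $\kappa$ with these first-column hook lengths are the $m$-rows of $\kappa$. The $m$-boundary of $\kappa$ is the set of boxes with hook length less than $m$. The skew length of an $(a,b)$-core $\kappa$ is the number of boxes simultaneously located in the $a$-rows and the $b$-boundary of $\kappa$. *)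

(* Defs.v *)
From mathcomp Require Import all_boot.

Set Implicit Arguments.
Unset Strict Implicit.
Unset Printing Implicit Defensive.

(* A partition is the weakly decreasing sequence of its (positive) parts. *)
Definition is_partition (kappa : seq nat) : bool :=
  sorted geq kappa && (0 \notin kappa).

(* English notation: the box (i, j) lies in row i (counted from the top) and
   column j (counted from the left), both starting from 0. *)
Definition boxes (kappa : seq nat) : seq (nat * nat) :=
  [seq (i, j) | i <- iota 0 (size kappa), j <- iota 0 (nth 0 kappa i)].

Definition hook_length (kappa : seq nat) (c : nat * nat) : nat :=
  count (fun d => (d.1 == c.1) && (c.2 <= d.2) || (d.2 == c.2) && (c.1 <= d.1))
        (boxes kappa).

Definition is_core (a b : nat) (kappa : seq nat) : bool :=
  is_partition kappa &&
  all (fun c => (hook_length kappa c != a) && (hook_length kappa c != b))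
      (boxes kappa).

Definition first_column_hooks (kappa : seq nat) : seq nat :=
  [seq hook_length kappa c | c <- boxes kappa & c.2 == 0].

(* The largest first-column hook length in each occurring residue class. *)
Definition residue_maxima (m : nat) (kappa : seq nat) : seq nat :=
  [seq h <- first_column_hooks kappa |
    all (fun h' => (h' == h %[mod m]) ==> (h' <= h)) (first_column_hooks kappa)].

Definition in_mrows (m : nat) (kappa : seq nat) (c : nat * nat) : bool :=
  hook_length kappa (c.1, 0) \in residue_maxima m kappa.

Definition in_mboundary (m : nat) (kappa : seq nat) (c : nat * nat) : bool :=
  hook_length kappa c < m.

Definition skew_length (a b : nat) (kappa : seq nat) : nat :=
  count (fun c => in_mrows a kappa c && in_mboundary b kappa c) (boxes kappa).

(* Main.v *)
Require Import Defs.
From mathcomp Require Import all_boot.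
From mathcomp Require Import zify.

Set Implicit Arguments.
Unset Strict Implicit.
Unset Printing Implicit Defensive.

(** Write [H] for the set of first-column hook lengths of [kappa].  The hook
    lengths in the row with first-column hook [h] are the differences [h - g],
    where [g] runs over the gaps of [H] below [h], that is, over the [g < h]
    outside [H] ([row_hooks]).  Hence [kappa] has no hook length [m] exactly
    when [H] is stable under [h |-> h - m] ([core_descends]), and then an
    element [h] is the largest of its class modulo [m] exactly when [h + m] is
    not in [H] ([residue_max_descends]).

    Let [G x] be the number of gaps below [x], zero for negative [x].  The row
    of [h] contains [G h - G (h - b)] boxes of hook length at most [b], and
    they form its part of the [b]-boundary because no hook length equals [b].
    Summing over the [a]-rows means summing over all of [H] and removing the
    terms with [h + a] in [H].  Put [h' = h + a]: by stability [h'] runs over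
    the elements of [H] that are at least [a], and the removed terms are
    [G (h' - a) - G (h' - a - b)].  The skew length is therefore the sum over
    [h] in [H] of

      [G h - G (h - a) - G (h - b) + G (h - (a + b))],

    which is symmetric in [a] and [b] ([skew_length_gaps]). *)

(** * Sets of natural numbers stable under subtraction *)

Definition descends (m : nat) (H : seq nat) : Prop :=
  forall h, h \in H -> m <= h -> h - m \in H.

Definition gaps (H : seq nat) (x : nat) : nat :=
  count (fun g => g \notin H) (iota 0 x).

(** Going down by steps of [m] from a larger element of the class of [h], one
    stays in [H] and meets [h + m] just before [h]. *)
Lemma residue_max_descends (m : nat) (H : seq nat) (h : nat) :
  0 < m -> descends m H ->
  all (fun h' => (h' == h %[mod m]) ==> (h' <= h)) H = (h + m \notin H).
Proof.
move=> m_gt0 Hm; apply/allP/idP => [Hmax | hm x xH].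
  apply/negP => /Hmax; rewrite modnDr eqxx /=; lia.
apply/implyP; rewrite leqNgt => /eqP xh; apply/negP => hx.
have [k Ek] : exists k, x = h + k.+1 * m.
  have /dvdnP[[|k] Ek] : m %| x - h by rewrite -eqn_mod_dvd ?xh // ltnW.
    lia.
  by exists k; lia.
elim: k x {xh hx} xH Ek => [|k IHk] x xH Ek.
  by rewrite Ek mul1n (negPf hm) in xH.
apply: (IHk (x - m)); last by lia.
by apply: Hm => //; lia.
Qed.

(** The gaps from [h - b] up to [h] are those with [h - g <= b], and the bound
    is strict because stability rules out the gap [g = h - b]. *)
Lemma gaps_window (b : nat) (H : seq nat) (h : nat) :
  descends b H -> h \in H ->
  count (fun g => (g \notin H) && (h - g < b)) (iota 0 h) + gaps H (h - b)
    = gaps H h.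
Proof.
move=> Hb hH; rewrite /gaps.
have -> : iota 0 h = iota 0 (h - b) ++ iota (h - b) (h - (h - b)).
  rewrite -[X in iota X (h - _)]add0n -iotaD; congr iota; lia.
rewrite !count_cat (@eq_in_count _ _ pred0); last first.
  by move=> g; rewrite mem_iota /= => hg; apply/andP => -[_]; lia.
rewrite count_pred0 add0n addnC; congr addn; apply: eq_in_count => g.
rewrite mem_iota => hg; have [//|gH /=] := boolP (g \in H).
apply/idP; rewrite ltnNge; apply/negP => le_b.
have Eg : g = h - b by lia.
by case/negP: gH; rewrite Eg; apply: Hb => //; lia.
Qed.

(** The substitution [h' = h + a].  For [h' < a] the truncated difference
    [h' - a] is zero and [F] vanishes there, so the right-hand side may range
    over all of [H]. *)
Lemma sum_shift (a : nat) (H : seq nat) (F : nat -> nat) :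
  uniq H -> descends a H -> F 0 = 0 ->
  \sum_(h <- H | h + a \in H) F h = \sum_(h <- H) F (h - a).
Proof.
move=> uH Ha F0; rewrite [RHS](bigID (fun h => a <= h)) /=.
rewrite [X in _ = _ + X]big1 ?addn0; last first.
  by move=> h; rewrite -ltnNge => /ltnW/eqP ->.
rewrite -[RHS]big_filter -big_filter.
have Hperm : perm_eq (map (addn^~ a) [seq h <- H | h + a \in H])
                     [seq h <- H | a <= h].
  apply: uniq_perm; rewrite ?filter_uniq //.
    by rewrite map_inj_uniq ?filter_uniq //; apply: addIn.
  move=> h; rewrite mem_filter; apply/mapP/andP => [[x + ->]|[ah hH]].
    by rewrite mem_filter leq_addl => /andP[].
  by exists (h - a); rewrite ?mem_filter ?subnK // hH; apply: Ha.
rewrite -(perm_big _ Hperm) big_map; apply: eq_bigr => h _.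
by rewrite addnK.
Qed.

(** The negative terms of the signed sum stand on the left, so that no
    subtraction of sums is truncated. *)
Lemma sum_window_gaps (a b : nat) (H : seq nat) :
  uniq H -> descends a H -> descends b H ->
  \sum_(h <- H | h + a \notin H)
      count (fun g => (g \notin H) && (h - g < b)) (iota 0 h)
    + \sum_(h <- H) gaps H (h - a) + \sum_(h <- H) gaps H (h - b)
  = \sum_(h <- H) gaps H h + \sum_(h <- H) gaps H (h - (a + b)).
Proof.
move=> uH Ha Hb.
pose W h := count (fun g => (g \notin H) && (h - g < b)) (iota 0 h).
have sumW : \sum_(h <- H) W h + \sum_(h <- H) gaps H (h - b)
            = \sum_(h <- H) gaps H h.
  rewrite -big_split /= big_seq [RHS]big_seq.
  by apply: eq_bigr => h hH; rewrite gaps_window.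
have sumWa : \sum_(h <- H | h + a \in H) W h
               + \sum_(h <- H) gaps H (h - (a + b))
             = \sum_(h <- H) gaps H (h - a).
  rewrite -(sum_shift (a := a) (F := gaps H)) //.
  have -> : \sum_(h <- H) gaps H (h - (a + b))
            = \sum_(h <- H) gaps H (h - a - b).
    by apply: eq_bigr => h _; rewrite subnDA.
  rewrite -(sum_shift (a := a) (F := fun h => gaps H (h - b))) //.
  rewrite -big_split /= big_seq_cond [RHS]big_seq_cond.
  by apply: eq_bigr => h /andP[hH _]; rewrite gaps_window.
rewrite (bigID (fun h => h + a \in H)) /= in sumW.
by rewrite -sumWa -sumW addnA [X in X + _ + _ = _]addnC addnAC.
Qed.

(** * Hook lengths of a partition *)

Lemma mem_boxes (kappa : seq nat) (i j : nat) :
  ((i, j) \in boxes kappa) = (i < size kappa) && (j < nth 0 kappa i).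
Proof.
apply/allpairsPdep/andP => [[x [y [+ + [-> ->]]]]|[iP jP]].
  by rewrite !mem_iota.
by exists i, j; rewrite !mem_iota.
Qed.

Lemma count_boxes (kappa : seq nat) (P : pred (nat * nat)) :
  count P (boxes kappa)
  = \sum_(0 <= i < size kappa)
      count (fun j => P (i, j)) (iota 0 (nth 0 kappa i)).
Proof.
rewrite count_flatten sumnE !big_map /index_iota subn0; apply: eq_bigr => i _.
by rewrite count_map.
Qed.

Lemma count_geq_iota (j n : nat) : count (leq j) (iota 0 n) = n - j.
Proof.
elim: n => // n IHn; rewrite -addn1 iotaD count_cat IHn /=.
by case: leqP; lia.
Qed.

Lemma hook_lengthE (kappa : seq nat) (i j : nat) : i < size kappa ->
  hook_length kappa (i, j)
  = (nth 0 kappa i - j)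
    + \sum_(i.+1 <= k < size kappa) (j < nth 0 kappa k).
Proof.
move=> ilt; rewrite /hook_length count_boxes /=.
rewrite (big_cat_nat (n := i)) //=; last exact: ltnW.
rewrite big_nat big1 ?add0n; last first.
  move=> k /andP[_ ki]; rewrite (@eq_count _ _ pred0) ?count_pred0 // => x /=.
  lia.
rewrite big_ltn //; congr addn.
  rewrite -count_geq_iota; apply: eq_count => x /=; lia.
rewrite big_nat [RHS]big_nat; apply: eq_bigr => k /andP[ik _].
have -> : (j < nth 0 kappa k) = (j \in iota 0 (nth 0 kappa k)).
  by rewrite mem_iota.
rewrite -count_uniq_mem ?iota_uniq //; apply: eq_count => x /=; lia.
Qed.

Lemma row_hook_le (kappa : seq nat) (i j : nat) : i < size kappa ->
  hook_length kappa (i, j) <= hook_length kappa (i, 0).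
Proof.
move=> ilt; rewrite !hook_lengthE //; apply: leq_add; first by lia.
by apply: leq_sum => k _; lia.
Qed.

Lemma row_hook_gt0 (kappa : seq nat) (i j : nat) : i < size kappa ->
  j < nth 0 kappa i -> 0 < hook_length kappa (i, j).
Proof. by move=> ilt jlt; rewrite hook_lengthE //; lia. Qed.

Section Partition.

Variable kappa : seq nat.
Hypothesis part_kappa : is_partition kappa.

Local Notation part := (nth 0 kappa).
Local Notation H := (first_column_hooks kappa).

Lemma part_gt0 i : i < size kappa -> 0 < part i.
Proof.
move=> ilt; rewrite lt0n; apply/eqP => p0.
by case/andP: part_kappa => _; rewrite -p0 mem_nth.
Qed.

Lemma part_geq i k : i <= k < size kappa -> part k <= part i.
Proof.
case/andP=> ik ks; case/andP: part_kappa => kappa_sorted _.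
have geq_trans : transitive geq by move=> x y z /= ? ?; lia.
have geq_refl : reflexive geq by move=> x /=.
by apply: (sorted_leq_nth geq_trans geq_refl 0 kappa_sorted);
  rewrite ?inE //; lia.
Qed.

Lemma first_column_hook i : i < size kappa ->
  hook_length kappa (i, 0) = part i + (size kappa - i.+1).
Proof.
move=> ilt; rewrite hook_lengthE // subn0; congr addn.
rewrite -[RHS]muln1 -sum_nat_const_nat big_nat [RHS]big_nat.
by apply: eq_bigr => k /andP[_ ?]; rewrite part_gt0.
Qed.

Lemma first_column_hooksE :
  H = [seq hook_length kappa (i, 0) | i <- iota 0 (size kappa)].
Proof.
rewrite /first_column_hooks /boxes filter_flatten map_flatten -!map_comp.
rewrite -[RHS]flatten_map1; congr flatten; apply/eq_in_map => i.
rewrite mem_iota add0n => /andP[_ /part_gt0] /=.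
case: (part i) => // p _ /=; congr cons.
rewrite filter_map -map_comp (eq_in_filter (a2 := pred0)) ?filter_pred0 //.
by move=> j; rewrite mem_iota /=; case: j.
Qed.

Lemma mem_first_column_hooks i : i < size kappa ->
  hook_length kappa (i, 0) \in H.
Proof.
by move=> ilt; rewrite first_column_hooksE; apply: map_f; rewrite mem_iota.
Qed.

Lemma first_column_hook_lt i k : i < k < size kappa ->
  hook_length kappa (k, 0) < hook_length kappa (i, 0).
Proof.
move=> ik; rewrite !first_column_hook; try lia.
by have := @part_geq i k; lia.
Qed.

Lemma first_column_hook_inj :
  {in iota 0 (size kappa) &, injective (fun i => hook_length kappa (i, 0))}.
Proof.
move=> i k; rewrite !mem_iota => ilt klt /= E.
have := @first_column_hook_lt i k; have := @first_column_hook_lt k i; lia.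
Qed.

Lemma first_column_hooks_uniq : uniq H.
Proof.
rewrite first_column_hooksE (map_inj_in_uniq first_column_hook_inj).
exact: iota_uniq.
Qed.

Lemma row_hooks_lt i j j' : i < size kappa -> j < j' < part i ->
  hook_length kappa (i, j') < hook_length kappa (i, j).
Proof.
move=> ilt jj'; rewrite !hook_lengthE // -addSn leq_add //; first by lia.
by apply: leq_sum => k _; lia.
Qed.

(** Let [h_k] be the first-column hook length of row [k] and [r] the number of
    rows.  The difference is [j] plus the number of rows after [i] that miss
    column [j].  It is below [h_k] for [k <= i].  For [k > i], compare it with
    [h_k = part k + (r - k - 1)]: if row [k] meets column [j], only rows after
    [k] can miss it, so the difference is at most [j + (r - k - 1) < h_k]; if
    row [k] misses column [j], so do all later rows, and the difference is at
    least [j + (r - k) > h_k]. *)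
Lemma row_hook_gap i j : i < size kappa -> j < part i ->
  hook_length kappa (i, 0) - hook_length kappa (i, j) \notin H.
Proof.
move=> ilt jlt; rewrite first_column_hooksE; apply/mapP => -[k].
rewrite mem_iota add0n => /andP[_ klt] E.
have hook_gt0 := row_hook_gt0 ilt jlt.
have ik : i < k.
  rewrite ltnNge leq_eqVlt; apply/negP => /orP[/eqP Eki|ki].
    by move: E; rewrite Eki; have := row_hook_le j ilt; lia.
  by have := @first_column_hook_lt k i; lia.
move: E; rewrite !first_column_hook // hook_lengthE //.
rewrite (big_cat_nat (n := k)) //=; last exact: ltnW.
have bound c (m n : nat) : \sum_(m <= l < n) (c < part l) <= n - m.
  rewrite -[leqRHS]muln1 -sum_nat_const_nat.
  by apply: leq_sum => l _; case: (_ < _).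
have [jk|kj] := ltnP j (part k).
  have -> : \sum_(i.+1 <= l < k) (j < part l) = k - i.+1.
    rewrite -[RHS]muln1 -sum_nat_const_nat big_nat [RHS]big_nat.
    by apply: eq_bigr => l il; have := @part_geq l k; lia.
  rewrite big_ltn // jk; lia.
have -> : \sum_(k <= l < size kappa) (j < part l) = 0.
  by rewrite big_nat big1 // => l kl; have := @part_geq k l; lia.
have := bound j i.+1 k; lia.
Qed.

(** By [row_hook_gap] the numbers [h - hook (i, j)] are distinct gaps below
    [h]; they exhaust the gaps because the later rows already provide
    [size kappa - i.+1] elements of [H] among the
    [h = part i + (size kappa - i.+1)] numbers below [h]. *)
Lemma row_hooks i : i < size kappa ->
  perm_eq [seq hook_length kappa (i, 0) - hook_length kappa (i, j)
          | j <- iota 0 (part i)]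
          [seq g <- iota 0 (hook_length kappa (i, 0)) | g \notin H].
Proof.
move=> ilt; set h := hook_length kappa (i, 0).
have hook_le j : hook_length kappa (i, j) <= h by apply: row_hook_le.
set s := (X in perm_eq X _); set t := (X in perm_eq _ X).
have us : uniq s.
  rewrite map_inj_in_uniq ?iota_uniq // => j j'; rewrite !mem_iota => jP j'P E.
  have := hook_le j; have := hook_le j'.
  have := @row_hooks_lt i j j'; have := @row_hooks_lt i j' j; lia.
have st : {subset s <= t}.
  move=> g /mapP[j]; rewrite mem_iota add0n => /andP[_ jP] ->.
  rewrite mem_filter row_hook_gap // mem_iota /=.
  have := row_hook_gt0 ilt jP; have := hook_le j; lia.
have later : size kappa - i.+1 <= count (mem H) (iota 0 h).
  pose u := [seq hook_length kappa (k, 0)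
            | k <- iota i.+1 (size kappa - i.+1)].
  have -> : size kappa - i.+1 = size u by rewrite size_map size_iota.
  rewrite -size_filter; apply: uniq_leq_size.
    rewrite map_inj_in_uniq ?iota_uniq // => k l.
    rewrite !mem_iota => kP lP.
    by apply: first_column_hook_inj; rewrite mem_iota; lia.
  move=> _ /mapP[k + ->]; rewrite mem_iota => kP.
  rewrite mem_filter mem_iota /= first_column_hook_lt ?andbT; last by lia.
  by apply: mem_first_column_hooks; lia.
have ts : size t <= size s.
  rewrite size_map size_iota size_filter.
  have : count (mem H) (iota 0 h) + count (fun g => g \notin H) (iota 0 h) = h.
    by rewrite -[RHS](size_iota 0) -(count_predC (mem H)).
  by rewrite [in RHS]/h first_column_hook //; lia.
have [_ Est] := uniq_min_size us st ts.
by apply: uniq_perm => //; rewrite filter_uniq ?iota_uniq.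
Qed.

(** If [h - m] were a gap, the row of [h] would have a box of hook length
    [h - (h - m) = m]. *)
Lemma core_descends m : 0 < m ->
  (forall c, c \in boxes kappa -> hook_length kappa c != m) -> descends m H.
Proof.
move=> m_gt0 no_m h; rewrite {1}first_column_hooksE => /mapP[i].
rewrite mem_iota add0n => /andP[_ ilt] -> le_mh; apply: contraT => gap.
have : hook_length kappa (i, 0) - m
    \in [seq g <- iota 0 (hook_length kappa (i, 0)) | g \notin H].
  by rewrite mem_filter gap mem_iota /=; lia.
rewrite -(perm_mem (row_hooks ilt)) => /mapP[j].
rewrite mem_iota add0n => /andP[_ jlt] E.
have /eqP[] : hook_length kappa (i, j) != m.
  by apply: no_m; rewrite mem_boxes ilt.
by rewrite -(subKn (row_hook_le j ilt)) -E subKn.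
Qed.

Lemma count_row_boundary b i : i < size kappa ->
  count (fun j => hook_length kappa (i, j) < b) (iota 0 (part i))
  = count (fun g => (g \notin H) && (hook_length kappa (i, 0) - g < b))
          (iota 0 (hook_length kappa (i, 0))).
Proof.
move=> ilt; set h := hook_length kappa (i, 0).
have -> : count (fun g => (g \notin H) && (h - g < b)) (iota 0 h)
          = count (fun g => h - g < b) [seq g <- iota 0 h | g \notin H].
  by rewrite count_filter; apply: eq_count => g /=; rewrite andbC.
rewrite -(permP (row_hooks ilt)) count_map; apply: eq_count => j /=.
by rewrite subKn // row_hook_le.
Qed.

Lemma skew_length_sum a b : 0 < a -> descends a H ->
  skew_length a b kappa
  = \sum_(h <- H | h + a \notin H)
      count (fun g => (g \notin H) && (h - g < b)) (iota 0 h).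
Proof.
move=> a_gt0 Ha; rewrite /skew_length count_boxes.
have sum_rows F : \sum_(h <- H) F h
    = \sum_(0 <= i < size kappa) F (hook_length kappa (i, 0)).
  by rewrite first_column_hooksE big_map /index_iota subn0.
rewrite [RHS]big_mkcond sum_rows big_nat [RHS]big_nat.
apply: eq_bigr => i /andP[_ ilt].
rewrite /in_mrows /in_mboundary /= mem_filter mem_first_column_hooks // andbT.
rewrite residue_max_descends // -count_row_boundary //.
by case: ifP => // _; rewrite count_pred0.
Qed.

End Partition.

(** * Symmetry of the skew length *)

Lemma skew_length_gaps (a b : nat) (kappa : seq nat) :
  0 < a -> 0 < b -> is_core a b kappa ->
  let H := first_column_hooks kappa in
  skew_length a b kappa
    + \sum_(h <- H) gaps H (h - a) + \sum_(h <- H) gaps H (h - b)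
  = \sum_(h <- H) gaps H h + \sum_(h <- H) gaps H (h - (a + b)).
Proof.
move=> a_gt0 b_gt0 /andP[part_kappa /allP no_ab] H.
have Ha : descends a H.
  by apply: core_descends => // c /no_ab /andP[].
have Hb : descends b H.
  by apply: core_descends => // c /no_ab /andP[].
by rewrite skew_length_sum // sum_window_gaps // first_column_hooks_uniq.
Qed.

Theorem corollary3p17 (a b : nat) (kappa : seq nat)
  (a_gt0 : 0 < a) (b_gt0 : 0 < b) (co_ab : coprime a b)
  (core_kappa : is_core a b kappa) :
  skew_length a b kappa = skew_length b a kappa.
Proof.
have core_kappa' : is_core b a kappa.
  case/andP: core_kappa => part_kappa no_ab; rewrite /is_core part_kappa /=.
  by apply: sub_all no_ab => c; rewrite andbC.
have := skew_length_gaps a_gt0 b_gt0 core_kappa.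
have := skew_length_gaps b_gt0 a_gt0 core_kappa'.
rewrite /= (addnC b a); lia.
Qed.
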